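(* Let $k$ be a field, let $(L,[\,,\,])$ be a Lie algebra over $k$, let $z\in Z(L)$ where $Z(L)=\{z\in L : [z,x]=0 \text{ for all } x\in L\}$ is the center of $L$, and let $\alpha\in k$. Let $r: L\otimes L\to L\otimes L$ be the $k$-linear map determined by $$r(x\otimes y)=[x,y]\otimes z-\alpha\, x\otimes y \qquad (x,y\in L).$$ Then $r$ satisfies the classical Yang-Baxter equation $$[r^{12},r^{13}]+[r^{12},r^{23}]+[r^{13},r^{23}]=0$$ as an identity of $k$-linear endomorphisms of $L\otimes L\otimes L$.
   Context: All tensor products are over $k$. For a $k$-vector space $V$, $I:V\to V$ is the identity map and $\tau:V\otimes V\to V\otimes V$ is the twist $\tau(v\otimes w)=w\otimes v$. For a $k$-linear map $R:V\otimes V\to V\otimes V$, define endomorphisms of $V\otimes V\otimes V$ by $R^{12}=R\otimes I$, $R^{23}=I\otimes R$, $R^{13}=(I\otimes\tau)(R\otimes I)(I\otimes\tau)$. In the classical Yang-Baxter equation, the outer brackets denote commutators of endomorphisms: $[f,g]=f\circ g-g\circ f$. *)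

(* Defs.v *)
From HB Require Import structures.
From mathcomp Require Import all_boot all_algebra.
From mathcomp Require Import finmap boolp.
From mathcomp Require Import monalg.

Set Implicit Arguments.
Unset Strict Implicit.
Unset Printing Implicit Defensive.

Import GRing.Theory.
Local Open Scope ring_scope.
Local Open Scope quotient_scope.

Section FreeModule.
Variables (k : fieldType) (X : choiceType) (U : lmodType k) (f : X -> U).

(* The linear extension of f : X -> U to the free module {malg k[X]}. *)
Definition free_lift (g : {malg k[X]}) : U := \sum_(x <- msupp g) g@_x *: f x.

Lemma free_liftEw (g : {malg k[X]}) (d : {fset X}) : (msupp g `<=` d)%fset ->
  free_lift g = \sum_(x <- d) g@_x *: f x.
Proof.
move=> gd; rewrite /free_lift (big_fset_incl _ gd) // => x _ xg.
by rewrite mcoeff_outdom // scale0r.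
Qed.

Lemma free_lift_is_linear : linear free_lift.
Proof.
move=> a g h; pose d := (msupp g `|` msupp h `|` msupp (a *: g + h))%fset.
have gd : (msupp g `<=` d)%fset by rewrite /d -fsetUA fsubsetUl.
have hd : (msupp h `<=` d)%fset.
  by rewrite /d (fsetUC (msupp g)) -fsetUA fsubsetUl.
rewrite (free_liftEw gd) (free_liftEw hd) (free_liftEw (fsubsetUr _ _ : (_ `<=` d)%fset)).
rewrite scaler_sumr -big_split /=; apply: eq_bigr => x _.
by rewrite mcoeffD mcoeffZ scalerDl scalerA.
Qed.

HB.instance Definition _ :=
  GRing.isLinear.Build k {malg k[X]} U _ free_lift free_lift_is_linear.

Lemma free_liftU x : free_lift << x >> = f x.
Proof.
rewrite (free_liftEw (msuppU_le : (_ `<=` [fset x])%fset)).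
by rewrite big_seq_fset1 mcoeffUU scale1r.
Qed.

End FreeModule.

Section Tensor.
Variables (k : fieldType) (V W : lmodType k).

(* The subspace of the free space on V * W generated by the bilinearity       *)
(* relations; the tensor product is the quotient by this subspace.            *)
Inductive tensor_rel : {malg k[(V * W)%type]} -> Prop :=
| tensor_rel_l a v v' w :
    tensor_rel (<< (a *: v + v', w) >> - (a *: << (v, w) >> + << (v', w) >>))
| tensor_rel_r a v w w' :
    tensor_rel (<< (v, a *: w + w') >> - (a *: << (v, w) >> + << (v, w') >>))
| tensor_rel0 : tensor_rel 0
| tensor_relP a g h : tensor_rel g -> tensor_rel h -> tensor_rel (a *: g + h).

Definition tensor_null : {pred {malg k[(V * W)%type]}} :=
  fun g => `[< tensor_rel g >].

Lemma tensor_null_submod : submod_closed tensor_null.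
Proof.
split=> [|a g h]; first by apply/asboolP; exact: tensor_rel0.
by move=> /asboolP gN /asboolP hN; apply/asboolP; exact: tensor_relP.
Qed.

HB.instance Definition _ := GRing.isSubmodClosed.Build k _ tensor_null
  tensor_null_submod.

Definition tensor := @Quotient.quot {malg k[(V * W)%type]} tensor_null.

HB.instance Definition _ := GRing.Zmodule.on tensor.
HB.instance Definition _ := Quotient.on tensor.

Fact tensor_key : unit. Proof. exact: tt. Qed.

Definition tensor_scale : k -> tensor -> tensor :=
  locked_with tensor_key (fun a t => \pi_tensor (a *: repr t)).
Canonical tensor_scale_unlockable := [unlockable of tensor_scale].

Lemma tensor_eqP (g h : {malg k[(V * W)%type]}) :
  reflect (\pi_tensor g = \pi_tensor h) (g - h \in tensor_null).
Proof.
rewrite (Quotient.idealrBE tensor_null g h); exact: eqP.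
Qed.

Lemma tensor_pi_scale a g :
  tensor_scale a (\pi_tensor g) = \pi_tensor (a *: g).
Proof.
rewrite unlock; apply/tensor_eqP; rewrite -scalerBr rpredZ //.
by apply/tensor_eqP; rewrite reprK.
Qed.

Lemma tensor_piD g h :
  \pi_tensor (g + h) = (\pi_tensor g + \pi_tensor h : tensor).
Proof. exact: (Quotient.pi_add tensor_null). Qed.

Lemma tensor_scaleA a b t :
  tensor_scale a (tensor_scale b t) = tensor_scale (a * b) t.
Proof. by rewrite -[t]reprK (tensor_pi_scale b) !tensor_pi_scale scalerA. Qed.

Lemma tensor_scale1 : left_id 1 tensor_scale.
Proof. by move=> t; rewrite -[t]reprK tensor_pi_scale scale1r. Qed.

Lemma tensor_scaleDr : right_distributive tensor_scale +%R.
Proof.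
move=> a s t; rewrite -[s]reprK -[t]reprK -tensor_piD !tensor_pi_scale.
by rewrite scalerDr tensor_piD.
Qed.

Lemma tensor_scaleDl t : {morph tensor_scale^~ t : a b / a + b}.
Proof.
by move=> a b; rewrite -[t]reprK !tensor_pi_scale scalerDl tensor_piD.
Qed.

HB.instance Definition _ := GRing.Zmodule_isLmodule.Build k tensor
  tensor_scaleA tensor_scale1 tensor_scaleDr tensor_scaleDl.

Lemma tensor_piP a g h :
  \pi_tensor (a *: g + h) = (a *: (\pi_tensor g : tensor) + \pi_tensor h).
Proof. by rewrite tensor_piD; congr (_ + _); rewrite -tensor_pi_scale. Qed.

Definition tens : V -> W -> tensor :=
  locked_with tensor_key (fun v w => \pi_tensor << (v, w) >>).
Canonical tens_unlockable := [unlockable of tens].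

Lemma tens_is_bilinear : bilinear_for *:%R *:%R tens.
Proof.
split=> [w a v v'|v a w w']; rewrite unlock -tensor_piP; apply/tensor_eqP.
  by apply/asboolP; exact: tensor_rel_l.
by apply/asboolP; exact: tensor_rel_r.
Qed.

HB.instance Definition _ := bilinear_isBilinear.Build k V W tensor *:%R *:%R
  tens tens_is_bilinear.

Lemma tensPl w a v v' : tens (a *: v + v') w = a *: tens v w + tens v' w.
Proof. exact: tens_is_bilinear.1. Qed.

Lemma tensPr v a w w' : tens v (a *: w + w') = a *: tens v w + tens v w'.
Proof. exact: tens_is_bilinear.2. Qed.

Section Lift.
Variables (U : lmodType k) (f : V -> W -> U).

(* Meaningful for f bilinear: see tensor_lift_is_linear and tensor_liftE. *)
Definition tensor_lift : tensor -> U :=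
  locked_with tensor_key
    (fun t => free_lift (fun p : V * W => f p.1 p.2) (repr t)).
Canonical tensor_lift_unlockable := [unlockable of tensor_lift].

Hypothesis fB : bilinear_for *:%R *:%R f.

Lemma tensor_lift_pi g :
  tensor_lift (\pi_tensor g) = free_lift (fun p : V * W => f p.1 p.2) g.
Proof.
rewrite unlock; apply/eqP; rewrite -subr_eq0 -linearB; apply/eqP.
have : repr (\pi_tensor g : tensor) - g \in tensor_null.
  by apply/tensor_eqP; rewrite reprK.
move=> /asboolP; elim=> [a v v' w|a v w w'||a h h' _ + _].
- by rewrite linearB linearP /= !free_liftU /= fB.1 subrr.
- by rewrite linearB linearP /= !free_liftU /= fB.2 subrr.
- exact: linear0.
- by move=> h0 h'0; rewrite linearP h0 h'0 /= scaler0 addr0.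
Qed.

Lemma tensor_lift_is_linear : linear tensor_lift.
Proof.
move=> a s t; rewrite -[s]reprK -[t]reprK -tensor_piP.
by rewrite !tensor_lift_pi linearP.
Qed.

Lemma tensor_liftE v w : tensor_lift (tens v w) = f v w.
Proof. by rewrite [tens]unlock tensor_lift_pi free_liftU. Qed.

End Lift.

Lemma tensor_ind (P : tensor -> Prop) :
  P 0 -> (forall a v w t, P t -> P (a *: tens v w + t)) -> forall t, P t.
Proof.
move=> P0 PD t; rewrite -[t]reprK; move: (repr t) => {t} g.
rewrite [g]monalgE; elim: (enum_fset (msupp g)) => [|p s IH].
  rewrite big_nil; have -> // : \pi_tensor 0 = 0 :> tensor.
  by apply: (@addrI _ (\pi_tensor 0 : tensor)); rewrite -tensor_piD !addr0.
rewrite big_cons.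
have -> : << g@_p *g p >> = g@_p *: << p >>.
  by apply/malgP => q; rewrite mcoeffZ !mcoeffU mulr_natr.
rewrite tensor_piP; case: p => v w.
by have := PD g@_(v, w) v w _ IH; rewrite [tens]unlock.
Qed.

Lemma tensor_ext (U : lmodType k) (f g : {linear tensor -> U}) :
  (forall v w, f (tens v w) = g (tens v w)) -> f =1 g.
Proof.
move=> fg; apply: tensor_ind => [|a v w t IH]; first by rewrite !linear0.
by rewrite !linearP fg IH.
Qed.

End Tensor.

Notation "v *t w" := (tens v w) (at level 40, left associativity) : ring_scope.

Section TensorMap.
Variables (k : fieldType) (V W V' W' : lmodType k).
Variables (f : {linear V -> V'}) (g : {linear W -> W'}).

Definition tensor_map : tensor V W -> tensor V' W' :=
  tensor_lift (fun v w => f v *t g w).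

Fact tensor_map_bilinear : bilinear_for *:%R *:%R (fun v w => f v *t g w).
Proof.
split=> [w a v v'|v a w w']; rewrite linearP; first exact: tensPl.
exact: tensPr.
Qed.

HB.instance Definition _ := GRing.isLinear.Build k _ _ _ tensor_map
  (tensor_lift_is_linear tensor_map_bilinear).

Lemma tensor_mapE v w : tensor_map (v *t w) = f v *t g w.
Proof. exact: (tensor_liftE tensor_map_bilinear). Qed.

End TensorMap.

Section Twist.
Variables (k : fieldType) (V W : lmodType k).

Definition twist : tensor V W -> tensor W V :=
  tensor_lift (fun v w => w *t v).

Fact twist_bilinear :
  bilinear_for *:%R *:%R (fun (v : V) (w : W) => w *t v).
Proof.
split=> [w a v v'|v a w w'].
  exact: tensPr.
exact: tensPl.
Qed.

HB.instance Definition _ := GRing.isLinear.Build k _ _ _ twist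
  (tensor_lift_is_linear twist_bilinear).

Lemma twistE v w : twist (v *t w) = w *t v.
Proof. exact: (tensor_liftE twist_bilinear). Qed.

End Twist.

Section Associator.
Variables (k : fieldType) (U V W : lmodType k).

Definition assocl_fun (u : U) : tensor V W -> tensor (tensor U V) W :=
  tensor_lift (fun v w => (u *t v) *t w).

Fact assocl_fun_bilinear1 (u : U) :
  bilinear_for *:%R *:%R (fun (v : V) (w : W) => (u *t v) *t w).
Proof.
split=> [w a v v'|v a w w'].
  by rewrite tensPr tensPl.
exact: tensPr.
Qed.

HB.instance Definition _ u := GRing.isLinear.Build k _ _ _ (assocl_fun u)
  (tensor_lift_is_linear (assocl_fun_bilinear1 u)).

Lemma assocl_funE u v w : assocl_fun u (v *t w) = (u *t v) *t w.
Proof. exact: (tensor_liftE (assocl_fun_bilinear1 u)). Qed.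

Fact assocl_bilinear : bilinear_for *:%R *:%R assocl_fun.
Proof.
split=> [t a u u'|u a t t']; last exact: linearP.
elim/tensor_ind: t => [|b v w t IH]; first by rewrite !linear0 /= scaler0 addr0.
rewrite 3!(linearP (assocl_fun _)) /= IH !assocl_funE.
rewrite tensPl tensPl !scalerDr.
by rewrite !scalerA (mulrC b a) addrACA.
Qed.

Definition assocl : tensor U (tensor V W) -> tensor (tensor U V) W :=
  tensor_lift assocl_fun.

HB.instance Definition _ := GRing.isLinear.Build k _ _ _ assocl
  (tensor_lift_is_linear assocl_bilinear).

Lemma assoclE u v w : assocl (u *t (v *t w)) = (u *t v) *t w.
Proof. by rewrite /assocl (tensor_liftE assocl_bilinear) assocl_funE. Qed.

Definition assocr_fun (w : W) : tensor U V -> tensor U (tensor V W) :=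
  tensor_lift (fun u v => u *t (v *t w)).

Fact assocr_fun_bilinear1 (w : W) :
  bilinear_for *:%R *:%R (fun (u : U) (v : V) => u *t (v *t w)).
Proof.
split=> [v a u u'|u a v v']; first exact: tensPl.
by rewrite tensPl tensPr.
Qed.

HB.instance Definition _ w := GRing.isLinear.Build k _ _ _ (assocr_fun w)
  (tensor_lift_is_linear (assocr_fun_bilinear1 w)).

Lemma assocr_funE u v w : assocr_fun w (u *t v) = u *t (v *t w).
Proof. exact: (tensor_liftE (assocr_fun_bilinear1 w)). Qed.

Fact assocr_bilinear : bilinear_for *:%R *:%R (fun t w => assocr_fun w t).
Proof.
split=> [w a t t'|t a w w']; first exact: linearP.
elim/tensor_ind: t => [|b u v t IH]; first by rewrite !linear0 /= scaler0 addr0.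
rewrite 3!(linearP (assocr_fun _)) /= IH !assocr_funE.
rewrite tensPr tensPr !scalerDr.
by rewrite !scalerA (mulrC b a) addrACA.
Qed.

Definition assocr : tensor (tensor U V) W -> tensor U (tensor V W) :=
  tensor_lift (fun t w => assocr_fun w t).

HB.instance Definition _ := GRing.isLinear.Build k _ _ _ assocr
  (tensor_lift_is_linear assocr_bilinear).

Lemma assocrE u v w : assocr ((u *t v) *t w) = u *t (v *t w).
Proof. by rewrite /assocr (tensor_liftE assocr_bilinear) assocr_funE. Qed.

End Associator.

(* V (x) V (x) V is represented as (V (x) V) (x) V, so that the identity on   *)
(* the first factor tensored with an endomorphism of the last two factors has *)
(* to be transported along the associator.                                    *)
Section YangBaxter.
Variables (k : fieldType) (V : lmodType k).
Local Notation V2 := (tensor V V).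
Local Notation V3 := (tensor (tensor V V) V).

Definition leg12 (R : {linear V2 -> V2}) : {linear V3 -> V3} :=
  tensor_map R idfun.

Definition leg23 (R : {linear V2 -> V2}) : {linear V3 -> V3} :=
  @assocl k V V V \o tensor_map idfun R \o @assocr k V V V.

Definition leg13 (R : {linear V2 -> V2}) : {linear V3 -> V3} :=
  leg23 (@twist k V V) \o leg12 R \o leg23 (@twist k V V).

Definition commutator (f g : {linear V3 -> V3}) : V3 -> V3 :=
  (f \o g) \- (g \o f).

Definition classical_yang_baxter (R : {linear V2 -> V2}) : Prop :=
  commutator (leg12 R) (leg13 R) \+ commutator (leg12 R) (leg23 R)
    \+ commutator (leg13 R) (leg23 R) =1 (fun=> 0).

Lemma leg12E R x y z : leg12 R ((x *t y) *t z) = R (x *t y) *t z.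
Proof. exact: tensor_mapE. Qed.

Lemma leg23E R x y z : leg23 R ((x *t y) *t z) = assocl (x *t R (y *t z)).
Proof. by rewrite /leg23 /= assocrE tensor_mapE. Qed.

Lemma leg13E R x y z : leg13 R ((x *t y) *t z) =
  leg23 (@twist k V V) (R (x *t z) *t y).
Proof.
transitivity (leg23 (@twist k V V)
    (leg12 R (leg23 (@twist k V V) ((x *t y) *t z)))); first by [].
by rewrite (leg23E (@twist k V V) x) [X in assocl (x *t X)]twistE assoclE leg12E.
Qed.

End YangBaxter.

HB.mixin Record Lmodule_isLie (k : fieldType) L of GRing.Lmodule k L := {
  lie : L -> L -> L;
  lie_is_bilinear : bilinear_for *:%R *:%R lie;
  liexx : forall x, lie x x = 0;
  lie_jacobi : forall x y z,
    lie x (lie y z) + lie y (lie z x) + lie z (lie x y) = 0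
}.

#[short(type="lieAlgType")]
HB.structure Definition LieAlgebra (k : fieldType) :=
  { L of GRing.Lmodule k L & Lmodule_isLie k L }.

Notation "[ 'lie' x , y ]" := (lie x y)
  (at level 0, format "[ 'lie'  x ,  y ]") : ring_scope.

Definition lie_center (k : fieldType) (L : lieAlgType k) (z : L) : Prop :=
  forall x : L, [lie z, x] = 0.

(* Existence of the map r determined by r (x (x) y) = [x, y] (x) z - alpha x (x) y;
   its uniqueness is tensor_ext. *)
Lemma lie_tensor_map_exists (k : fieldType) (L : lieAlgType k) (z : L) (alpha : k) :
  exists r : {linear tensor L L -> tensor L L},
    forall x y : L, r (x *t y) = [lie x, y] *t z - alpha *: (x *t y).
Proof.
pose f (x y : L) : tensor L L := [lie x, y] *t z - alpha *: (x *t y).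
have fB : bilinear_for *:%R *:%R f.
  split=> [y a x x'|x a y y']; rewrite /f /=.
    rewrite lie_is_bilinear.1 !tensPl scalerBr scalerDr.
    by rewrite !scalerA (mulrC a alpha) opprD addrACA.
  rewrite lie_is_bilinear.2 !tensPl tensPr.
  by rewrite scalerBr scalerDr !scalerA (mulrC a alpha) opprD addrACA.
pose rL := GRing.isLinear.Build k _ _ _ (tensor_lift f) (tensor_lift_is_linear fB).
pose r : {linear tensor L L -> tensor L L} := HB.pack (tensor_lift f) rL.
by exists r => x y; rewrite /= (tensor_liftE fB).
Qed.

(* Main.v *)
(** Scalar operators commute with everything, so the term in [alpha] drops out
of each commutator and one may take [alpha = 0]. As [z] is central, on
[x (x) y (x) w] the three commutators then sum to
[([[x, w], y] - [[x, y], w] + [x, [y, w]]) (x) z (x) z], which vanishes by the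
Jacobi identity. *)

Require Import Defs.
From HB Require Import structures.
From mathcomp Require Import all_boot all_algebra.
Import GRing.Theory.
Local Open Scope ring_scope.

Lemma tensor3_ext (k : fieldType) (V1 V2 V3 U : lmodType k)
    (f g : {linear tensor (tensor V1 V2) V3 -> U}) :
  (forall x y w, f (x *t y *t w) = g (x *t y *t w)) -> f =1 g.
Proof.
move=> fg; apply: tensor_ext => t w.
elim/tensor_ind: t => [|a x y t IH]; first by rewrite linear0l !linear0.
by rewrite tensPl !linearP fg IH.
Qed.

(** Here [ft] and [gt] are the values at [t] of [f + a] and [g + a], while [fgt] and [gft] are those
    of their two composites. Adding scalars leaves a commutator unchanged. *)
Lemma commutator_shift {k : fieldType} {V : lmodType k}
    {f g : {linear tensor (tensor V V) V -> tensor (tensor V V) V}} {a : k}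
    {t ft gt fgt gft} :
  f t = ft - a *: t -> g t = gt - a *: t ->
  f gt = fgt - a *: gt -> g ft = gft - a *: ft ->
  commutator f g t = fgt - gft.
Proof.
move=> ftE gtE fgtE gftE.
have fg : f (g t) = fgt - a *: (gt + f t).
  by rewrite gtE linearB linearZ /= fgtE scalerDr opprD addrA.
have gf : g (f t) = gft - a *: (ft + g t).
  by rewrite ftE linearB linearZ /= gftE scalerDr opprD addrA.
(* Both composites thus carry the same correction term, which cancels. *)
have swap : gt + f t = ft + g t by rewrite ftE gtE addrCA.
by rewrite /commutator /= fg gf swap opprB addrA subrK.
Qed.

HB.instance Definition _ (k : fieldType) (L : lieAlgType k) :=
  bilinear_isBilinear.Build k L L L *:%R *:%R (@lie k L) (@lie_is_bilinear k L).

Lemma lie_antisym {k : fieldType} {L : lieAlgType k} (x y : L) :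
  [lie x, y] = - [lie y, x].
Proof.
have := liexx (x + y); rewrite linearDl !linearDr /= !liexx add0r addr0.
by move/eqP; rewrite addr_eq0 => /eqP.
Qed.

Section LieMap.
Context {k : fieldType} {L : lieAlgType k} {z : L} {alpha : k}.
Context {r : {linear tensor L L -> tensor L L}}.
Hypothesis hr :
  forall x y : L, r (x *t y) = [lie x, y] *t z - alpha *: (x *t y).

Lemma leg12_lie x y w :
  leg12 r (x *t y *t w) = [lie x, y] *t z *t w - alpha *: (x *t y *t w).
Proof. by rewrite leg12E hr linearBl linearZl. Qed.

Lemma leg23_lie x y w :
  leg23 r (x *t y *t w) = x *t [lie y, w] *t z - alpha *: (x *t y *t w).
Proof. by rewrite leg23E hr linearBr linearZr linearB linearZ /= !assoclE. Qed.

Lemma leg13_lie x y w :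
  leg13 r (x *t y *t w) = [lie x, w] *t y *t z - alpha *: (x *t y *t w).
Proof.
rewrite leg13E hr linearBl linearZl linearB linearZ /=.
(* The outer twist brings [y] back to the middle slot. *)
by rewrite !assocrE !tensor_mapE /= !twistE !assoclE.
Qed.

End LieMap.

Theorem theorem5p11 (k : fieldType) (L : lieAlgType k) (z : L)
  (hz : lie_center z) (alpha : k)
  (r : {linear tensor L L -> tensor L L})
  (hr : forall x y : L, r (x *t y) = [lie x, y] *t z - alpha *: (x *t y)) :
  classical_yang_baxter r.
Proof.
pose V3 := tensor (tensor L L) L.
(* [c] is [commutator] bundled as a linear map, so that [tensor3_ext] applies. *)
pose c (f g : {linear V3 -> V3}) : {linear V3 -> V3} := (f \o g) \- (g \o f).
pose s : {linear V3 -> V3} :=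
  c (leg12 r) (leg13 r) \+ c (leg12 r) (leg23 r) \+ c (leg13 r) (leg23 r).
have hz' (x : L) : [lie x, z] = 0 by rewrite lie_antisym hz oppr0.
apply: (@tensor3_ext _ _ _ _ _ s \0) => x y w.
have l12 := leg12_lie hr; have l13 := leg13_lie hr; have l23 := leg23_lie hr.
transitivity (commutator (leg12 r) (leg13 r) (x *t y *t w)
  + commutator (leg12 r) (leg23 r) (x *t y *t w)
  + commutator (leg13 r) (leg23 r) (x *t y *t w)); first by [].
(* Up to the term in [alpha], each leg sends a pure tensor to a pure tensor, so the same formulas
   also serve for the second application. *)
rewrite (commutator_shift (l12 _ _ _) (l13 _ _ _) (l12 _ _ _) (l13 _ _ _)).
rewrite (commutator_shift (l12 _ _ _) (l23 _ _ _) (l12 _ _ _) (l23 _ _ _)).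
rewrite (commutator_shift (l13 _ _ _) (l23 _ _ _) (l13 _ _ _) (l23 _ _ _)).
(* Three of the six products vanish: 23 after 12 contains [[lie z, w]], 13 after 23 contains
   [[lie x, z]], and 23 after 13 contains [[lie y, z]]. *)
rewrite !hz !hz' !linear0l ![_ *t 0]linear0r !linear0l /= !subr0 addr0.
have jacobi : [lie [lie x, w], y] - [lie [lie x, y], w] + [lie x, [lie y, w]] = 0.
  (* Antisymmetry turns the first two terms into [[lie y, [lie w, x]]] and [[lie w, [lie x, y]]],
     giving the cyclic form. *)
  rewrite (lie_antisym _ y) (lie_antisym x w) linearNr opprK (lie_antisym _ w).
  by rewrite opprK -(lie_jacobi x y w) addrC addrA.
by rewrite -!linearBl -!linearDl jacobi !linear0l.
Qed.
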